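(* Let $R$ be a commutative, non-noetherian absolutely flat ring which is not semi-artinian. Then the residue fields of $R$ do not generate $\mathsf{D}(R)$, i.e. $$\langle k(\mathfrak{p}) \mid \mathfrak{p}\in \operatorname{Spec} R\rangle \subsetneq \mathsf{D}(R).$$
   Context: All rings are commutative and unital. A ring $R$ is absolutely flat (von Neumann regular) if for every $r\in R$ there is $x\in R$ with $r=r^2x$. A ring $R$ is semi-artinian if every non-zero homomorphic image of $R$, in the category of $R$-modules, contains a simple submodule. $\mathsf{D}(R)$ is the unbounded derived category of $R$-modules, and $k(\mathfrak{p})$ is the residue field at the prime $\mathfrak{p}$, regarded as an object of $\mathsf{D}(R)$. A localising subcategory is a full triangulated subcategory closed under arbitrary coproducts; $\langle\mathcal{C}\rangle$ denotes the smallest localising subcategory containing $\mathcal{C}$. *)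

(* Defs.v *)
From HB Require Import structures.
From mathcomp Require Import all_boot all_order all_algebra.
From mathcomp Require Import boolp.

Set Implicit Arguments.
Unset Strict Implicit.
Unset Printing Implicit Defensive.

Import GRing.Theory.
Local Open Scope ring_scope.

Definition absolutely_flat (R : comNzRingType) : Prop :=
  forall r : R, exists x : R, r = r ^+ 2 * x.

Definition is_ideal (R : comNzRingType) (I : R -> Prop) : Prop :=
  I 0 /\ forall a u v : R, I u -> I v -> I (a * u + v).

Definition finitely_generated (R : comNzRingType) (I : R -> Prop) : Prop :=
  exists (n : nat) (g : 'I_n -> R), forall x : R,
    I x <-> exists c : 'I_n -> R, x = \sum_(i < n) c i * g i.

Definition noetherian (R : comNzRingType) : Prop :=
  forall I : R -> Prop, is_ideal I -> finitely_generated I.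

Section Modules.
Variable R : comNzRingType.

Definition is_submodule (M : lmodType R) (N : M -> Prop) : Prop :=
  N 0 /\ forall (a : R) (u v : M), N u -> N v -> N (a *: u + v).

Definition is_simple_submodule (M : lmodType R) (N : M -> Prop) : Prop :=
  [/\ is_submodule N,
      exists2 x, N x & x <> 0 &
      forall L : M -> Prop, is_submodule L -> (forall x, L x -> N x) ->
        (forall x, L x -> x = 0) \/ (forall x, N x -> L x)].

Definition semi_artinian : Prop :=
  forall (M : lmodType R) (f : {linear R^o -> M}),
    (forall y : M, exists x : R^o, f x = y) ->
    (exists y : M, y <> 0) ->
    exists N : M -> Prop, is_simple_submodule N.

End Modules.

(* The points of Spec R are the prime ideals of the library, which are          *)
(* boolean predicates; classically these are all the prime ideals of R.         *)
Definition Spec (R : comNzRingType) : Type := prime_idealr R.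

Section ResidueField.
Variables (R : comNzRingType) (p : Spec R).

(* R / p, for which the library does not provide an integral domain structure   *)
(* because units and inverses need not be computable.                           *)
Definition quotient_domain : Type := {ideal_quot p}.

HB.instance Definition _ := GRing.ComNzRing.on quotient_domain.

Definition quotient_unit : pred quotient_domain :=
  fun x => `[< exists y, y * x == 1 >].

Definition quotient_inv (x : quotient_domain) : quotient_domain :=
  if pselect (exists y, y * x == 1) is left h then xchoose h else x.

Fact quotient_mulVr : {in quotient_unit, left_inverse 1 quotient_inv *%R}.
Proof.
move=> x /asboolP xP; rewrite /quotient_inv.
by case: pselect => // h; apply/eqP/(xchooseP h).
Qed.

Fact quotient_unitP (x y : quotient_domain) : y * x = 1 -> quotient_unit x.
Proof. by move=> yx1; apply/asboolP; exists y; apply/eqP. Qed.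

Fact quotient_inv_out : {in [predC quotient_unit], quotient_inv =1 id}.
Proof.
move=> x /asboolPn xP; rewrite /quotient_inv.
by case: pselect.
Qed.

HB.instance Definition _ := GRing.ComNzRing_hasMulInverse.Build quotient_domain
  quotient_mulVr quotient_unitP quotient_inv_out.

Fact quotient_idomainP (x y : quotient_domain) :
  x * y = 0 -> (x == 0) || (y == 0).
Proof. exact: (@Quotient.rquot_IdomainAxiom R p). Qed.

HB.instance Definition _ :=
  GRing.ComUnitRing_isIntegral.Build quotient_domain quotient_idomainP.

Definition residue_field : Type := {fraction quotient_domain}.

HB.instance Definition _ := GRing.Field.on residue_field.

Definition to_residue_field (a : R) : residue_field :=
  FracField.tofrac (\pi_({ideal_quot p})%qT a : quotient_domain).

Definition residue_scale (a : R) (x : residue_field) : residue_field :=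
  to_residue_field a * x.

Fact residue_scaleA a b x :
  residue_scale a (residue_scale b x) = residue_scale (a * b) x.
Proof.
rewrite /residue_scale /to_residue_field mulrA -tofracM.
by congr (FracField.tofrac _ * _); rewrite -[LHS]rmorphM.
Qed.

Fact residue_scale1 : left_id 1 residue_scale.
Proof.
move=> x; rewrite /residue_scale /to_residue_field.
by rewrite [X in FracField.tofrac X]rmorph1 tofrac1 mul1r.
Qed.

Fact residue_scaleDr : right_distributive residue_scale +%R.
Proof. by move=> a x y; rewrite /residue_scale mulrDr. Qed.

Fact residue_scaleDl x : {morph residue_scale^~ x : a b / a + b}.
Proof.
move=> a b; rewrite /residue_scale /to_residue_field -mulrDl -tofracD.
by congr (FracField.tofrac _ * _); rewrite -[RHS]rmorphD.
Qed.

HB.instance Definition _ := GRing.Zmodule_isLmodule.Build R residue_field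
  residue_scaleA residue_scale1 residue_scaleDr residue_scaleDl.

End ResidueField.

Section Complexes.
Variable R : comNzRingType.

(* Unbounded cochain complexes of R-modules.                                    *)
Record complex : Type := Complex {
  cobj :> int -> lmodType R;
  cdiff : forall n : int, {linear cobj n -> cobj (n + 1)};
  cdiffK : forall (n : int) (x : cobj n), cdiff (n + 1) (cdiff n x) = 0
}.

Record chmap (X Y : complex) : Type := ChMap {
  chmap_fun :> forall n : int, {linear X n -> Y n};
  chmapE : forall (n : int) (x : X n),
    chmap_fun (n + 1) (cdiff X n x) = cdiff Y n (chmap_fun n x)
}.

Definition chmap_id (X : complex) : chmap X X :=
  @ChMap X X (fun n => idfun) (fun n x => erefl).

Fact chmap_comp_subproof (X Y Z : complex) (g : chmap Y Z) (f : chmap X Y)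
    (n : int) (x : X n) :
  (g (n + 1) \o f (n + 1)) (cdiff X n x) = cdiff Z n ((g n \o f n) x).
Proof. by rewrite /= !chmapE. Qed.

Definition chmap_comp (X Y Z : complex) (g : chmap Y Z) (f : chmap X Y) :
    chmap X Z :=
  @ChMap X Z (fun n => g n \o f n) (chmap_comp_subproof g f).

(* Cocycles and coboundaries are taken in degree n + 1, with n ranging over all *)
(* of int, so that both differentials at that degree are available without      *)
(* transport along n - 1 + 1 = n.                                               *)
Definition cocycle (X : complex) (n : int) (x : X (n + 1)) : Prop :=
  cdiff X (n + 1) x = 0.

Definition coboundary (X : complex) (n : int) (x : X (n + 1)) : Prop :=
  exists y : X n, x = cdiff X n y.

(* For every n, the map H^(n+1)(f) : H^(n+1)(X) -> H^(n+1)(Y) is injective and  *)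
(* surjective, where H^(n+1) = cocycles / coboundaries.                         *)
Definition quasi_iso (X Y : complex) (f : chmap X Y) : Prop :=
  forall n : int,
    (forall x : X (n + 1), cocycle x -> coboundary (f (n + 1) x) ->
       coboundary x) /\
    (forall y : Y (n + 1), cocycle y ->
       exists2 x : X (n + 1), cocycle x & coboundary (y - f (n + 1) x)).

Section Shift.

Definition shift_diff (X : complex) (n : int) : X (n + 1) -> X (n + 1 + 1) :=
  fun x => - cdiff X (n + 1) x.

Fact shift_diff_linear (X : complex) (n : int) : linear (@shift_diff X n).
Proof. by move=> a x y; rewrite /shift_diff linearP opprD scalerN. Qed.

HB.instance Definition _ (X : complex) (n : int) :=
  GRing.isLinear.Build R (X (n + 1)) (X (n + 1 + 1)) *:%R (@shift_diff X n)
    (@shift_diff_linear X n).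

Fact shift_diffK (X : complex) (n : int) (x : X (n + 1)) :
  shift_diff (shift_diff x) = 0.
Proof. by rewrite /shift_diff linearN cdiffK oppr0 oppr0. Qed.

Definition shift (X : complex) : complex :=
  @Complex (fun n => X (n + 1)) (fun n => @shift_diff X n) (@shift_diffK X).

Fact shift_map_subproof (X Y : complex) (f : chmap X Y) (n : int)
    (x : shift X n) :
  f (n + 1 + 1) (cdiff (shift X) n x) = cdiff (shift Y) n (f (n + 1) x).
Proof. by rewrite /= /shift_diff linearN chmapE. Qed.

Definition shift_map (X Y : complex) (f : chmap X Y) :
    chmap (shift X) (shift Y) :=
  @ChMap (shift X) (shift Y) (fun n => f (n + 1)) (shift_map_subproof f).

Fact shift_quasi_iso (X Y : complex) (f : chmap X Y) :
  quasi_iso f -> quasi_iso (shift_map f).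
Proof.
have shc (Z : complex) n (z : shift Z (n + 1)) :
    @cocycle (shift Z) n z <-> @cocycle Z (n + 1) z.
  rewrite /cocycle /= /shift_diff; split=> [/eqP|->]; last by rewrite oppr0.
  by rewrite oppr_eq0 => /eqP.
have shb (Z : complex) n (z : shift Z (n + 1)) :
    @coboundary (shift Z) n z <-> @coboundary Z (n + 1) z.
  by split=> -[y ->]; exists (- y); rewrite /= /shift_diff linearN ?opprK.
move=> qf n; have [finj fsurj] := qf (n + 1); split=> [x /shc xc /shb fx|y /shc].
  by apply/shb/finj.
by move/fsurj=> [x /shc xc /shb xb]; exists x.
Qed.

End Shift.

Section Cone.
Variables (X Y : complex) (f : chmap X Y).

Definition cone_obj (n : int) : lmodType R := (X (n + 1)%R * Y n)%type.

Definition cone_diff (n : int) (z : cone_obj n) : cone_obj (n + 1) :=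
  (- cdiff X (n + 1) z.1, f (n + 1) z.1 + cdiff Y n z.2).

Fact cone_diff_linear (n : int) : linear (@cone_diff n).
Proof.
move=> a [x y] [x' y']; rewrite /cone_diff /=.
by congr (_, _); rewrite /= !linearP /= ?opprD ?scalerN // scalerDr addrACA.
Qed.

HB.instance Definition _ (n : int) :=
  GRing.isLinear.Build R (cone_obj n) (cone_obj (n + 1)) *:%R (@cone_diff n)
    (@cone_diff_linear n).

Fact cone_diffK (n : int) (z : cone_obj n) :
  cone_diff (cone_diff z) = 0.
Proof.
case: z => x y; rewrite /cone_diff /=.
by rewrite !linearN !linearD /= !cdiffK chmapE addr0 opprK addNr.
Qed.

Definition cone : complex :=
  @Complex cone_obj (fun n => @cone_diff n) cone_diffK.

Definition cone_in_fun (n : int) (y : Y n) : cone n := (0, y).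

Fact cone_in_linear (n : int) : linear (@cone_in_fun n).
Proof.
by move=> a x y; apply/eqP; rewrite xpair_eqE /= scaler0 addr0 !eqxx.
Qed.

HB.instance Definition _ (n : int) :=
  GRing.isLinear.Build R (Y n) (cone n) *:%R (@cone_in_fun n)
    (@cone_in_linear n).

Fact cone_in_subproof (n : int) (y : Y n) :
  cone_in_fun (cdiff Y n y) = cdiff cone n (cone_in_fun y).
Proof. by rewrite /= /cone_diff /= !linear0 add0r. Qed.

Definition cone_in : chmap Y cone :=
  @ChMap Y cone (fun n => @cone_in_fun n) cone_in_subproof.

Definition cone_out_fun (n : int) (z : cone n) : shift X n := z.1.

Fact cone_out_linear (n : int) : linear (@cone_out_fun n).
Proof. by []. Qed.

HB.instance Definition _ (n : int) :=
  GRing.isLinear.Build R (cone n) (shift X n) *:%R (@cone_out_fun n)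
    (@cone_out_linear n).

Fact cone_out_subproof (n : int) (z : cone n) :
  cone_out_fun (cdiff cone n z) = cdiff (shift X) n (cone_out_fun z).
Proof. by []. Qed.

Definition cone_out : chmap cone (shift X) :=
  @ChMap cone (shift X) (fun n => @cone_out_fun n) cone_out_subproof.

End Cone.

Definition stalk_obj (M : lmodType R) (n : int) : lmodType R :=
  if n is Posz 0 then M else 'rV[R]_0.

Fact stalk_diffK (M : lmodType R) (n : int) (x : stalk_obj M n) :
  (\0 : {linear stalk_obj M (n + 1) -> stalk_obj M (n + 1 + 1)})
    ((\0 : {linear stalk_obj M n -> stalk_obj M (n + 1)}) x) = 0.
Proof. by []. Qed.

(* The module M regarded as a complex concentrated in degree 0.                 *)
Definition stalk (M : lmodType R) : complex :=
  @Complex (stalk_obj M) (fun n => \0) (@stalk_diffK M).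

Definition zero_complex : complex := stalk 'rV[R]_0.

(* D(R) is the localisation of the category of complexes at the quasi-          *)
(* isomorphisms, in the sense of Gabriel and Zisman: its objects are the        *)
(* complexes, and its morphisms are the formal composites of chain maps and of  *)
(* formal inverses of quasi-isomorphisms, modulo the congruence Deq generated   *)
(* by the category laws, by the composition of chain maps and by the            *)
(* requirement that the formal inverses be inverses. Hom-sets are represented   *)
(* as setoids (Dhom X Y, Deq).                                                  *)
Inductive Dhom : complex -> complex -> Type :=
| Dmap X Y (f : chmap X Y) : Dhom X Y
| Dinv X Y (s : chmap X Y) (qs : quasi_iso s) : Dhom Y X
| Dcomp X Y Z (g : Dhom Y Z) (f : Dhom X Y) : Dhom X Z.

Definition Did (X : complex) : Dhom X X := Dmap (chmap_id X).

Inductive Deq : forall X Y : complex, Dhom X Y -> Dhom X Y -> Prop :=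
| Deq_refl X Y (f : Dhom X Y) : Deq f f
| Deq_sym X Y (f g : Dhom X Y) : Deq f g -> Deq g f
| Deq_trans X Y (f g h : Dhom X Y) : Deq f g -> Deq g h -> Deq f h
| Deq_comp X Y Z (g g' : Dhom Y Z) (f f' : Dhom X Y) :
    Deq g g' -> Deq f f' -> Deq (Dcomp g f) (Dcomp g' f')
| Deq_compA X Y Z T (h : Dhom Z T) (g : Dhom Y Z) (f : Dhom X Y) :
    Deq (Dcomp h (Dcomp g f)) (Dcomp (Dcomp h g) f)
| Deq_comp1l X Y (f : Dhom X Y) : Deq (Dcomp (Did Y) f) f
| Deq_comp1r X Y (f : Dhom X Y) : Deq (Dcomp f (Did X)) f
| Deq_map X Y (f g : chmap X Y) :
    (forall n x, f n x = g n x) -> Deq (Dmap f) (Dmap g)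
| Deq_map_comp X Y Z (g : chmap Y Z) (f : chmap X Y) :
    Deq (Dmap (chmap_comp g f)) (Dcomp (Dmap g) (Dmap f))
| Deq_mapV X Y (s : chmap X Y) (qs : quasi_iso s) :
    Deq (Dcomp (Dmap s) (Dinv qs)) (Did Y)
| Deq_Vmap X Y (s : chmap X Y) (qs : quasi_iso s) :
    Deq (Dcomp (Dinv qs) (Dmap s)) (Did X).

Definition is_Diso (X Y : complex) (f : Dhom X Y) : Prop :=
  exists g : Dhom Y X, Deq (Dcomp g f) (Did X) /\ Deq (Dcomp f g) (Did Y).

Fixpoint Dshift (X Y : complex) (f : Dhom X Y) : Dhom (shift X) (shift Y) :=
  match f with
  | Dmap _ _ f => Dmap (shift_map f)
  | Dinv _ _ _ qs => Dinv (shift_quasi_iso qs)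
  | Dcomp _ _ _ g f => Dcomp (Dshift g) (Dshift f)
  end.

Fact Dshift_Deq (X Y : complex) (f g : Dhom X Y) :
  Deq f g -> Deq (Dshift f) (Dshift g).
Proof.
elim=> {X Y f g} /= [X Y f|X Y f g _|X Y f g h _ fg _|X Y Z g g' f f' _ gg' _
  |X Y Z T h g f|X Y f|X Y f|X Y f g fg|X Y Z g f|X Y s qs|X Y s qs].
- exact: Deq_refl.
- exact: Deq_sym.
- exact: Deq_trans.
- exact: Deq_comp.
- exact: Deq_compA.
- apply: Deq_trans (Deq_comp1l _); apply: Deq_comp (Deq_refl _).
  exact: Deq_map.
- apply: Deq_trans (Deq_comp1r _); apply: Deq_comp (Deq_refl _) _.
  exact: Deq_map.
- by apply: Deq_map => n x; apply: fg.
- by apply: Deq_trans (Deq_map_comp _ _); apply: Deq_map.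
- by apply: Deq_trans (Deq_mapV _) _; apply: Deq_map.
- by apply: Deq_trans (Deq_Vmap _) _; apply: Deq_map.
Qed.

(* X -f-> Y -g-> Z -h-> X[1] is isomorphic in D(R), as a triangle, to the       *)
(* mapping cone triangle A -u-> B -> cone u -> A[1] of a chain map u.           *)
Definition distinguished (X Y Z : complex)
    (f : Dhom X Y) (g : Dhom Y Z) (h : Dhom Z (shift X)) : Prop :=
  exists (A B : complex) (u : chmap A B)
         (a : Dhom X A) (b : Dhom Y B) (c : Dhom Z (cone u)),
    [/\ is_Diso a, is_Diso b & is_Diso c] /\
    [/\ Deq (Dcomp b f) (Dcomp (Dmap u) a),
        Deq (Dcomp c g) (Dcomp (Dmap (cone_in u)) b) &
        Deq (Dcomp (Dshift a) h) (Dcomp (Dmap (cone_out u)) c)].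

(* Full subcategories of D(R) are represented by their classes of objects.      *)
Record triangulated_subcategory (P : complex -> Prop) : Prop := {
  tri_zero : P zero_complex;
  tri_iso : forall (X Y : complex) (f : Dhom X Y), is_Diso f -> P X -> P Y;
  tri_shift : forall X : complex, P X <-> P (shift X);
  tri_cone : forall (X Y Z : complex)
      (f : Dhom X Y) (g : Dhom Y Z) (h : Dhom Z (shift X)),
    distinguished f g h -> P X -> P Y -> P Z
}.

Definition is_coproduct (I : Type) (X : I -> complex) (S : complex)
    (inj : forall i, Dhom (X i) S) : Prop :=
  forall (T : complex) (f : forall i, Dhom (X i) T),
    (exists h : Dhom S T, forall i, Deq (Dcomp h (inj i)) (f i)) /\
    (forall h h' : Dhom S T,
       (forall i, Deq (Dcomp h (inj i)) (Dcomp h' (inj i))) -> Deq h h').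

(* Coproducts are indexed by small sets, i.e. by types in the universe of the   *)
(* carriers of modules; small_carrier makes that universe large enough.         *)
Definition small_type := Type.
Definition small_carrier (M : lmodType R) : small_type := M.

Definition localising_subcategory (P : complex -> Prop) : Prop :=
  triangulated_subcategory P /\
  forall (I : small_type) (X : I -> complex) (S : complex)
      (inj : forall i, Dhom (X i) S),
    is_coproduct inj -> (forall i, P (X i)) -> P S.

(* The smallest localising subcategory containing C.                            *)
Definition localising_closure (C : complex -> Prop) (X : complex) : Prop :=
  forall P : complex -> Prop, localising_subcategory P ->
    (forall Y, C Y -> P Y) -> P X.

Definition whole_category (X : complex) : Prop := True.

Definition strict_subcategory (P Q : complex -> Prop) : Prop :=
  (forall X, P X -> Q X) /\ exists2 X, Q X & ~ P X.

Definition residue_fields (X : complex) : Prop :=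
  exists p : Spec R, X = stalk (residue_field p).

End Complexes.

Arguments residue_fields R X : clear implicits.
Arguments whole_category R X : clear implicits.

(* Main.v *)
From HB Require Import structures.
Require Import Defs.
From mathcomp Require Import all_boot all_order all_algebra.
From mathcomp Require Import finmap boolp classical_sets fsbigop.

Set Implicit Arguments.
Unset Strict Implicit.
Unset Printing Implicit Defensive.

Import GRing.Theory.
Local Open Scope ring_scope.

(** Since R is not semi-artinian, some nonzero module M has no simple submodule.
    Call a subset A of R dense when no nonzero element of M is killed by A. The
    modules all of whose elements have dense annihilator form a hereditary
    torsion class: they are the modules without nonzero maps to the injective
    hull of M. As this class is closed under submodules, quotients, extensions
    and direct sums, the complexes with torsion cohomology form a localising
    subcategory of D(R).

    It contains every residue field. In an absolutely flat ring a prime p is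
    maximal, and k(p) is killed by p; if p killed a nonzero element m of M, then
    R m would be isomorphic to R / p, a simple submodule ([dense_prime]). It
    does not contain R, because the annihilator of 1 is zero and M is not
    ([stalk_regular_not_torsion]). So R is not generated by the residue fields.

    What takes work is that the class is closed in D(R), where morphisms are
    formal composites. Invariance under isomorphism needs the action of such
    composites on cohomology, which is kept here as a relation between cocycles
    ([Hrel], [Deq_Hrel]). Cones follow from a direct computation
    ([torsion_complex_cone]).

    Coproducts are given by their universal property in D(R), and its uniqueness
    half is what carries the argument. Let S be a coproduct of torsion complexes
    X_i. Each X_i -> S is a left fraction ([left_fraction]), and the cone of its numerator
    yields a chain map q_i : S -> C_i that kills X_i in D(R) and whose kernel on
    cohomology is torsion ([torsion_kernel]). Glue all the C_i along S, that is,
    take the homotopy pushout T of the sum map from a direct sum of copies of S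
    to S and of the direct sum of the q_i. The map S -> T kills every X_i, hence
    is zero in D(R), hence is zero on cohomology; but a class killed in T is a
    finite sum of classes killed by the various q_i, hence torsion
    ([torsion_complex_coproduct]). *)

Definition linear_of (R : comNzRingType) (U V : lmodType R) (f : U -> V)
    (fl : linear f) : {linear U -> V} :=
  HB.pack f (GRing.isLinear.Build R U V *:%R f fl).

(** * The action of derived morphisms on cohomology *)

Section Cohomology.
Variable R : comNzRingType.
Implicit Types X Y Z : complex R.

Lemma coboundary0 X n : coboundary (0 : X (n + 1)).
Proof. by exists 0; rewrite linear0. Qed.

Lemma coboundaryP X n (a : R) (x y : X (n + 1)) :
  coboundary x -> coboundary y -> coboundary (a *: x + y).
Proof. by move=> [u ->] [v ->]; exists (a *: u + v); rewrite linearP. Qed.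

Lemma coboundaryZ X n (a : R) (x : X (n + 1)) :
  coboundary x -> coboundary (a *: x).
Proof. by move=> [u ->]; exists (a *: u); rewrite linearZ. Qed.

Lemma coboundaryD X n (x y : X (n + 1)) :
  coboundary x -> coboundary y -> coboundary (x + y).
Proof. by move=> [u ->] [v ->]; exists (u + v); rewrite linearD. Qed.

Lemma coboundaryN X n (x : X (n + 1)) : coboundary x -> coboundary (- x).
Proof. by move=> [u ->]; exists (- u); rewrite linearN. Qed.

Lemma coboundaryB X n (x y : X (n + 1)) :
  coboundary x -> coboundary y -> coboundary (x - y).
Proof. by move=> xb yb; apply: coboundaryD => //; apply: coboundaryN. Qed.

Lemma coboundary_map X Y (f : chmap X Y) n (x : X (n + 1)) :
  coboundary x -> coboundary (f (n + 1) x).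
Proof. by move=> [u ->]; exists (f n u); rewrite chmapE. Qed.

Lemma coboundary_cocycle X n (x : X (n + 1)) : coboundary x -> cocycle x.
Proof. by move=> [u ->]; rewrite /cocycle cdiffK. Qed.

Lemma cocycleP X n (a : R) (x y : X (n + 1)) :
  cocycle x -> cocycle y -> cocycle (a *: x + y).
Proof. by rewrite /cocycle linearP => -> ->; rewrite scaler0 addr0. Qed.

Lemma cocycleZ X n (a : R) (x : X (n + 1)) : cocycle x -> cocycle (a *: x).
Proof. by rewrite /cocycle linearZ => /= ->; rewrite scaler0. Qed.

Lemma cocycle_map X Y (f : chmap X Y) n (x : X (n + 1)) :
  cocycle x -> cocycle (f (n + 1) x).
Proof. by rewrite /cocycle -chmapE => ->; rewrite linear0. Qed.

Lemma quasi_iso_id X : quasi_iso (chmap_id X).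
Proof.
move=> n; split=> // y yc; exists y => //=; rewrite subrr; exact: coboundary0.
Qed.

Lemma quasi_iso_comp X Y Z (g : chmap Y Z) (f : chmap X Y) :
  quasi_iso g -> quasi_iso f -> quasi_iso (chmap_comp g f).
Proof.
move=> qg qf n; have [gi gs] := qg n; have [fi fs] := qf n; split=> [x xc|z zc].
  by move=> /gi-/(_ (cocycle_map f xc))/fi; apply.
have [y yc zy] := gs z zc; have [x xc yx] := fs y yc; exists x => //=.
have -> : z - g (n + 1) (f (n + 1) x)
        = (z - g (n + 1) y) + g (n + 1) (y - f (n + 1) x).
  by rewrite linearB addrA subrK.
by apply: coboundaryD => //; apply: coboundary_map.
Qed.

(** The graph, on cocycles, of the map induced on cohomology. A relation lets a
    formal inverse act by the converse of the relation of the quasi-isomorphism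
    that it inverts, without forming cohomology modules. *)
Fixpoint Hrel X Y (f : Dhom X Y) n : X (n + 1) -> Y (n + 1) -> Prop :=
  match f with
  | Dmap _ _ f => fun x y =>
      [/\ cocycle x, cocycle y & coboundary (y - f (n + 1) x)]
  | Dinv _ _ s _ => fun y x =>
      [/\ cocycle x, cocycle y & coboundary (y - s (n + 1) x)]
  | Dcomp _ _ _ g f => fun x z =>
      exists2 y, @Hrel _ _ f n x y & @Hrel _ _ g n y z
  end.

Lemma Hrel_cocycle X Y (f : Dhom X Y) n x y :
  @Hrel X Y f n x y -> cocycle x /\ cocycle y.
Proof.
elim: f n x y => {X Y} [X Y f|X Y s qs|X Y Z g IHg f IHf] n x y /=.
- by case.
- by case.
- by case=> t /IHf[? ?] /IHg[? ?].
Qed.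

Lemma Hrel_total X Y (f : Dhom X Y) n x :
  cocycle x -> exists y, @Hrel X Y f n x y.
Proof.
elim: f n x => {X Y} [X Y f|X Y s qs|X Y Z g IHg f IHf] n x xc /=.
- exists (f (n + 1) x); split=> //; first exact: cocycle_map.
  by rewrite subrr; apply: coboundary0.
- by have [_ /(_ x xc)[y yc xy]] := qs n; exists y.
- have [y xy] := IHf n x xc; have [_ yc] := Hrel_cocycle xy.
  by have [z yz] := IHg n y yc; exists z; exists y.
Qed.

Lemma Hrel_linear X Y (f : Dhom X Y) n (a : R) x y x' y' :
  @Hrel X Y f n x y -> @Hrel X Y f n x' y' ->
  Hrel f (a *: x + x') (a *: y + y').
Proof.
have E (V W : complex R) (g : chmap V W) (v v' : V (n + 1)) (w w' : W (n + 1)) :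
    a *: w + w' - g (n + 1) (a *: v + v')
    = a *: (w - g (n + 1) v) + (w' - g (n + 1) v').
  by rewrite linearP scalerBr opprD addrACA.
elim: f x y x' y' => {X Y} [X Y f|X Y s qs|X Y Z g IHg f IHf] x y x' y' /=.
- move=> [? ? b] [? ? b']; split; try exact: cocycleP.
  by rewrite E; apply: coboundaryP.
- move=> [? ? b] [? ? b']; split; try exact: cocycleP.
  by rewrite E; apply: coboundaryP.
- move=> [t xt ty] [t' xt' ty']; exists (a *: t + t'); [exact: IHf|exact: IHg].
Qed.

Lemma Hrel_preserves_coboundary X Y (f : Dhom X Y) n x y :
  @Hrel X Y f n x y -> coboundary x -> coboundary y.
Proof.
elim: f x y => {X Y} [X Y f|X Y s qs|X Y Z g IHg f IHf] x y /=.
- move=> [_ _ b] xb; rewrite -[y](subrK (f (n + 1) x)).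
  by apply: coboundaryD => //; apply: coboundary_map.
- move=> [yc _ b] xb; have [si _] := qs n; apply: si => //.
  rewrite -[s _ y](subKr x); exact: coboundaryB.
- by move=> [t /IHf + /IHg] => + + xb => /(_ xb) tb /(_ tb).
Qed.

Lemma Hrel_coboundaries X Y (f : Dhom X Y) n (x : X (n + 1)) (y : Y (n + 1)) :
  coboundary x -> coboundary y -> Hrel f x y.
Proof.
elim: f x y => {X Y} [X Y f|X Y s qs|X Y Z g IHg f IHf] x y xb yb /=.
- split; try exact: coboundary_cocycle.
  by apply: coboundaryB => //; apply: coboundary_map.
- split; try exact: coboundary_cocycle.
  by apply: coboundaryB => //; apply: coboundary_map.
- exists 0; [apply: IHf|apply: IHg] => //; exact: coboundary0.
Qed.

Lemma Hrel_cohomologousl X Y (f : Dhom X Y) n x x' y :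
  coboundary (x' - x) -> @Hrel X Y f n x y -> Hrel f x' y.
Proof.
move=> xb xy; have := Hrel_linear 1 (Hrel_coboundaries f xb (coboundary0 Y n)) xy.
by rewrite scaler0 add0r scale1r subrK.
Qed.

Lemma Hrel_cohomologousr X Y (f : Dhom X Y) n x y y' :
  coboundary (y' - y) -> @Hrel X Y f n x y -> Hrel f x y'.
Proof.
move=> xb xy; have := Hrel_linear 1 (Hrel_coboundaries f (coboundary0 X n) xb) xy.
by rewrite scaler0 add0r scale1r subrK.
Qed.

(** Cohomology is a functor on D(R). The two halves of the definition of a
    quasi-isomorphism are what makes the last two generators of the congruence
    hold. *)
Lemma Deq_Hrel X Y (f g : Dhom X Y) : Deq f g ->
  forall n x y, @Hrel X Y f n x y <-> @Hrel X Y g n x y.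
Proof.
elim=> {X Y f g} [X Y f|X Y f g _ IH|X Y f g h _ IHfg _ IHgh
  |X Y Z g g' f f' _ IHg _ IHf
  |X Y Z T h g f|X Y f|X Y f|X Y f g fg|X Y Z g f|X Y s qs|X Y s qs] n x y.
- by [].
- by rewrite IH.
- by rewrite IHfg.
- by split=> -[t /IHf xt /IHg ty]; exists t.
- split=> [[t [u xu ut] ty]|[u xu [t ut ty]]]; [exists u => //|exists t => //].
    by exists t.
  by exists u.
- split=> [[t xt [_ _ ty]]|xy]; first exact: Hrel_cohomologousr ty xt.
  exists y => //; have [_ yc] := Hrel_cocycle xy; split=> //=.
  by rewrite subrr; apply: coboundary0.
- split=> [[t [_ _ xt] ty]|xy].
    apply: Hrel_cohomologousl ty; rewrite -opprB; exact: coboundaryN.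
  exists x => //; have [xc _] := Hrel_cocycle xy; split=> //=.
  by rewrite subrr; apply: coboundary0.
- by rewrite /= fg.
- split=> [[xc yc xy]|[t [xc tc xt] [_ yc ty]]].
    exists (f (n + 1) x); split=> //; try exact: cocycle_map.
    by rewrite subrr; apply: coboundary0.
  split=> //=; rewrite -[y](subrK (g (n + 1) t)) -addrA -linearB.
  by apply: coboundaryD => //; apply: coboundary_map.
- split=> [[t [tc xc xt] [_ yc yt]]|[xc yc xy]].
    by split=> //=; rewrite -[y - x](subrKA (s (n + 1) t)) -[_ - x]opprB;
      apply: coboundaryB.
  have [_ /(_ x xc)[t tc xt]] := qs n; exists t; split=> //.
  by rewrite -[y](subrK x) -addrA; apply: coboundaryD.
- have [si _] := qs n; split=> [[t [xc tc tx] [yc _ ty]]|[xc yc xy]].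
    split=> //=; apply: si; first by rewrite addrC -scaleN1r; apply: cocycleP.
    rewrite linearB -[_ - _](subrKA t) addrC -[_ - t]opprB.
    exact: coboundaryB.
  exists (s (n + 1) x); split=> //; try exact: cocycle_map.
    by rewrite subrr; apply: coboundary0.
  by rewrite -linearB; apply: coboundary_map; rewrite -opprB; apply: coboundaryN.
Qed.

End Cohomology.

(** * Homotopy pushouts *)

Section DoubleCylinder.
Variables (R : comNzRingType) (Y V U : complex R).
Variables (s : chmap Y V) (h : chmap Y U).

(** The homotopy pushout of V <-s- Y -h-> U, that is the mapping cone of
    (s, - h) : Y -> V + U. It is used in place of the homotopy pullback because
    it involves Y in degree n + 1 only: a pullback would need degree n - 1, and
    transport along n - 1 + 1 = n. *)
Definition dcyl_obj (n : int) : lmodType R := (V n * Y (n + 1)%R * U n)%type.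

Definition dcyl_diff (n : int) (z : dcyl_obj n) : dcyl_obj (n + 1) :=
  (cdiff V n z.1.1 + s (n + 1) z.1.2, - cdiff Y (n + 1) z.1.2,
   cdiff U n z.2 - h (n + 1) z.1.2).

Fact dcyl_diff_linear n : linear (@dcyl_diff n).
Proof.
move=> a [[v y] u] [[v' y'] u']; rewrite /dcyl_diff /=.
congr (_, _, _); rewrite /= !linearP /=.
- by rewrite scalerDr addrACA.
- by rewrite ?opprD ?scalerN.
- by rewrite ?scalerBr ?opprD ?scalerN addrACA ?scalerBr.
Qed.

Fact dcyl_diffK n (z : dcyl_obj n) : dcyl_diff (dcyl_diff z) = 0.
Proof.
case: z => [[v y] u]; rewrite /dcyl_diff /=; congr (_, _, _).
- by rewrite linearD linearN /= cdiffK chmapE add0r subrr.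
- by rewrite !linearN /= cdiffK !oppr0.
- by rewrite linearB linearN /= cdiffK chmapE add0r opprK addNr.
Qed.

Definition dcyl : complex R :=
  @Complex R dcyl_obj (fun n => linear_of (@dcyl_diff_linear n)) dcyl_diffK.

Fact dcyl_inl_linear n : linear (fun v : V n => (v, 0, 0) : dcyl n).
Proof. by move=> a v v'; congr (_, _, _); rewrite /= scaler0 addr0. Qed.

Fact dcyl_inlE n (v : V n) :
  linear_of (@dcyl_inl_linear (n + 1)) (cdiff V n v)
  = cdiff dcyl n (linear_of (@dcyl_inl_linear n) v).
Proof. by rewrite /= /dcyl_diff /= !linear0 !addr0 ?oppr0. Qed.

Definition dcyl_inl : chmap V dcyl := ChMap dcyl_inlE.

Fact dcyl_inr_linear n : linear (fun u : U n => (0, 0, u) : dcyl n).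
Proof. by move=> a v v'; congr (_, _, _); rewrite /= scaler0 addr0. Qed.

Fact dcyl_inrE n (u : U n) :
  linear_of (@dcyl_inr_linear (n + 1)) (cdiff U n u)
  = cdiff dcyl n (linear_of (@dcyl_inr_linear n) u).
Proof. by rewrite /= /dcyl_diff /= !linear0 !addr0 ?oppr0 ?subr0. Qed.

Definition dcyl_inr : chmap U dcyl := ChMap dcyl_inrE.

(** Homotopy pushouts preserve quasi-isomorphisms: the cokernel of [dcyl_inr] is
    the mapping cone of s, which is acyclic. *)
Lemma dcyl_inr_quasi_iso : quasi_iso s -> quasi_iso dcyl_inr.
Proof.
move=> qs n; split=> [u uc [[[v y] u'] /= []]|[[v y] u] []].
- move=> /esym/addr0_eq sy.
  move=> /esym /eqP; rewrite oppr_eq0 => /eqP yc ->.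
  have [y' ->] : coboundary y.
    have [si _] := qs n; apply: si => //; rewrite -sy.
    by apply: coboundaryN; exists v.
  by exists (u' - h n y'); rewrite linearB chmapE.
- move=> vy /eqP; rewrite oppr_eq0 => /eqP yc /eqP; rewrite subr_eq0 => /eqP uy.
  have [si _] := qs (n + 1).
  have [y1 y1E] : coboundary y.
    apply: si => //; exists (- v); rewrite linearN.
    exact/esym/addr0_eq.
  (* y1 need not satisfy s y1 = - v, but the defect is a cocycle, which a cocycle
     y2 of Y corrects up to a coboundary. *)
  have [_ ss] := qs n.
  have [y2 y2c [v' v'E]] : exists2 y2 : Y (n + 1), cocycle y2
      & coboundary (v + s (n + 1) y1 - s (n + 1) y2).
    by apply: ss; rewrite /cocycle linearD /= -chmapE -y1E.
  exists (u + h (n + 1) (y2 - y1)).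
    rewrite /cocycle linearD /= -chmapE linearB /= y2c -y1E sub0r linearN uy.
    exact: subrr.
  exists (v', y2 - y1, 0); rewrite /= /dcyl_diff /=.
  congr (_, _, _); rewrite /=.
  + by rewrite -v'E linearB subr0 subrKA addrK.
  + by rewrite linearB y2c sub0r opprK subr0.
  + by rewrite linear0 opprD addNKr add0r.
Qed.

End DoubleCylinder.

(** * Calculus of left fractions *)

Section Homotopy.
Variables (R : comNzRingType) (X Y : complex R) (f g : chmap X Y).
Variable k : forall n, {linear X (n + 1) -> Y n}.
Hypothesis kE : forall n (x : X (n + 1)),
  f (n + 1) x - g (n + 1) x = cdiff Y n (k n x) + k (n + 1) (cdiff X (n + 1) x).

Local Notation C := (dcyl (chmap_id X) (chmap_id X)).

(** A homotopy from f to g is a map to Y from the cylinder of X that restricts to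
    f and g on the two ends. *)
Fact homotopy_map_linear n :
  linear (fun z : C n => f n z.1.1 + k n z.1.2 + g n z.2).
Proof.
move=> a [[v y] u] [[v' y'] u'] /=; rewrite !linearP /= !scalerDr.
by rewrite [X in X + _ = _]addrACA [LHS]addrACA.
Qed.

Fact homotopy_mapE n (z : C n) :
  linear_of (@homotopy_map_linear (n + 1)) (cdiff C n z)
  = cdiff Y n (linear_of (@homotopy_map_linear n) z).
Proof.
have dk y : cdiff Y n (k n y)
    = f (n + 1) y - g (n + 1) y - k (n + 1) (cdiff X _ y).
  by rewrite kE addrK.
case: z => [[v y] u] /=; rewrite !linearD !linearN /= -!chmapE dk.
rewrite -2![LHS]addrA -[RHS]addrA; congr (_ + _).
by rewrite [LHS]addrA -[RHS]addrA [RHS]addrACA; congr (_ + _); apply: addrC.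
Qed.

Definition homotopy_map : chmap C Y := ChMap homotopy_mapE.
End Homotopy.

Section Fractions.
Variable R : comNzRingType.
Implicit Types X Y Z : complex R.

Lemma Deq_compl X Y Z (g : Dhom Y Z) (f f' : Dhom X Y) :
  Deq f f' -> Deq (Dcomp g f) (Dcomp g f').
Proof. by move=> ff'; apply: Deq_comp => //; apply: Deq_refl. Qed.

Lemma Deq_compr X Y Z (g g' : Dhom Y Z) (f : Dhom X Y) :
  Deq g g' -> Deq (Dcomp g f) (Dcomp g' f).
Proof. by move=> gg'; apply: Deq_comp => //; apply: Deq_refl. Qed.

Lemma Deq_compAC X Y Z T (h : Dhom Z T) (g : Dhom Y Z) (f : Dhom X Y) :
  Deq (Dcomp (Dcomp h g) f) (Dcomp h (Dcomp g f)).
Proof. by apply: Deq_sym; apply: Deq_compA. Qed.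

Lemma Deq_mapC X Y Z (g : chmap Y Z) (f : chmap X Y) (e : chmap X Z) :
  (forall n x, g n (f n x) = e n x) -> Deq (Dcomp (Dmap g) (Dmap f)) (Dmap e).
Proof.
move=> gf; apply: Deq_trans (Deq_sym (Deq_map_comp _ _)) _.
exact: Deq_map.
Qed.

(** The two ends of a cylinder become equal in D(R), since both are sections of
    the projection p and one of them is invertible there. *)
Lemma Deq_dcyl_id X :
  Deq (Dmap (dcyl_inl (chmap_id X) (chmap_id X)))
      (Dmap (dcyl_inr (chmap_id X) (chmap_id X))).
Proof.
set i0 := dcyl_inl _ _; set i1 := dcyl_inr _ _.
have q1 : quasi_iso i1 by apply: dcyl_inr_quasi_iso; apply: quasi_iso_id.
have kE n (x : X (n + 1)) : chmap_id X (n + 1) x - chmap_id X (n + 1) x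
    = cdiff X n ((\0 : {linear X (n + 1) -> X n}) x)
      + (\0 : {linear X (n + 1 + 1) -> X (n + 1)}) (cdiff X (n + 1) x).
  by rewrite subrr linear0 addr0.
pose p := homotopy_map (k := fun n => \0) kE.
have pi0 : Deq (Dcomp (Dmap p) (Dmap i0)) (Did X).
  by apply: Deq_mapC => n x /=; rewrite !addr0.
have pi1 : Deq (Dcomp (Dmap p) (Dmap i1)) (Did X).
  by apply: Deq_mapC => n x /=; rewrite !add0r.
(* p is a retraction of the isomorphism i1, hence its inverse. *)
have i1p : Deq (Dcomp (Dmap i1) (Dmap p)) (Did _).
  apply: Deq_trans (Deq_mapV q1); apply: Deq_compl.
  apply: Deq_trans (Deq_sym (Deq_comp1r _)) _.
  apply: Deq_trans (Deq_compl _ (Deq_sym (Deq_mapV q1))) _.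
  apply: Deq_trans (Deq_compA _ _ _) _.
  by apply: Deq_trans (Deq_compr _ pi1) (Deq_comp1l _).
apply: Deq_trans (Deq_sym (Deq_comp1l _)) _.
apply: Deq_trans (Deq_compr _ (Deq_sym i1p)) _.
apply: Deq_trans (Deq_compAC _ _ _) _.
by apply: Deq_trans (Deq_compl _ pi0) (Deq_comp1r _).
Qed.

Lemma homotopic_Deq X Y (f g : chmap X Y)
    (k : forall n, {linear X (n + 1) -> Y n}) :
  (forall n (x : X (n + 1)), f (n + 1) x - g (n + 1) x
     = cdiff Y n (k n x) + k (n + 1) (cdiff X (n + 1) x)) ->
  Deq (Dmap f) (Dmap g).
Proof.
move=> kE; pose F := homotopy_map kE.
have Fl : Deq
    (Dcomp (Dmap F) (Dmap (dcyl_inl (chmap_id X) (chmap_id X)))) (Dmap f).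
  by apply: Deq_mapC => n x /=; rewrite !linear0 !addr0.
have Fr : Deq
    (Dcomp (Dmap F) (Dmap (dcyl_inr (chmap_id X) (chmap_id X)))) (Dmap g).
  by apply: Deq_mapC => n x /=; rewrite !linear0 !add0r.
apply: Deq_trans (Deq_sym Fl) _; apply: Deq_trans Fr.
by apply: Deq_compl; apply: Deq_dcyl_id.
Qed.

Fact dcyl_homotopy_linear Y V U (s : chmap Y V) (h : chmap Y U) n :
  linear (fun y : Y (n + 1) => (0, y, 0) : dcyl s h n).
Proof. by move=> a y y'; congr (_, _, _); rewrite /= scaler0 addr0. Qed.

(** The homotopy is the inclusion of the middle summand. *)
Lemma Deq_dcyl Y V U (s : chmap Y V) (h : chmap Y U) :
  Deq (Dcomp (Dmap (dcyl_inl s h)) (Dmap s))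
      (Dcomp (Dmap (dcyl_inr s h)) (Dmap h)).
Proof.
apply: Deq_trans (Deq_sym (Deq_map_comp _ _)) _.
apply: Deq_trans (Deq_map_comp _ _).
apply: (homotopic_Deq (k := fun n => linear_of (@dcyl_homotopy_linear _ _ _ s h n))).
move=> n y; rewrite /= /dcyl_diff /=.
congr (_, _, _); rewrite /= ?linear0 ?subr0 ?add0r ?addr0 //.
by rewrite addNr.
Qed.

Fact zero_chmapE X Y n (x : X n) :
  (\0 : {linear X (n + 1) -> Y (n + 1)}) (cdiff X n x)
  = cdiff Y n ((\0 : {linear X n -> Y n}) x).
Proof. by rewrite /= linear0. Qed.

Definition zero_chmap X Y : chmap X Y := ChMap (@zero_chmapE X Y).

(** A zero map factors through any denominator, which absorbs the formal
    inverses in f. *)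
Lemma Deq_zerol X Y Z (f : Dhom X Y) :
  Deq (Dcomp (Dmap (zero_chmap Y Z)) f) (Dmap (zero_chmap X Z)).
Proof.
elim: f Z => {X Y} [X Y f|X Y s qs|X Y Z g IHg f IHf] T.
- exact: Deq_mapC.
- have sE : Deq (Dmap (zero_chmap X T)) (Dcomp (Dmap (zero_chmap Y T)) (Dmap s)).
    by apply: Deq_sym; apply: Deq_mapC.
  apply: Deq_trans (Deq_compr _ sE) _; apply: Deq_trans (Deq_compAC _ _ _) _.
  by apply: Deq_trans (Deq_compl _ (Deq_mapV qs)) (Deq_comp1r _).
- by apply: Deq_trans (Deq_compA _ _ _) (Deq_trans (Deq_compr _ (IHg T)) (IHf T)).
Qed.

Lemma Deq_zeror X Y Z (g : chmap Y Z) :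
  Deq (Dcomp (Dmap g) (Dmap (zero_chmap X Y))) (Dmap (zero_chmap X Z)).
Proof. by apply: Deq_mapC => n x /=; rewrite linear0. Qed.

(** The derived category has a calculus of left fractions: to compose, the
    numerator of the second fraction is pushed out along the denominator of the
    first. *)
Lemma left_fraction X Y (f : Dhom X Y) :
  exists (V : complex R) (s : chmap Y V) (g : chmap X V),
    quasi_iso s /\ Deq (Dcomp (Dmap s) f) (Dmap g).
Proof.
elim: f => {X Y} [X Y f|X Y s qs
  |X Y Z f2 [U [t [h [qt tE]]]] f [V [s [g [qs sE]]]]].
- exists Y, (chmap_id Y), f; split; [exact: quasi_iso_id|exact: Deq_comp1l].
- exists Y, s, (chmap_id Y); split=> //; exact: Deq_mapV.
- exists (dcyl s h), (chmap_comp (dcyl_inr s h) t).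
  exists (chmap_comp (dcyl_inl s h) g).
  split; first by apply: quasi_iso_comp => //; apply: dcyl_inr_quasi_iso.
  apply: Deq_trans (Deq_compr _ (Deq_map_comp _ _)) _.
  apply: Deq_trans (Deq_compAC _ _ _) _.
  apply: Deq_trans (Deq_compl _ (Deq_trans (Deq_compA _ _ _) (Deq_compr _ tE))) _.
  apply: Deq_trans (Deq_compA _ _ _) _.
  apply: Deq_trans (Deq_compr _ (Deq_sym (Deq_dcyl _ _))) _.
  apply: Deq_trans (Deq_compAC _ _ _) _.
  apply: Deq_trans (Deq_compl _ sE) _.
  exact: Deq_sym (Deq_map_comp _ _).
Qed.

Fact cone_homotopy_linear X Y (f : chmap X Y) n :
  linear (fun x : X (n + 1) => (x, 0) : cone f n).
Proof. by move=> a x x'; congr (_, _); rewrite /= scaler0 addr0. Qed.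

Lemma Deq_cone_in X Y (f : chmap X Y) :
  Deq (Dcomp (Dmap (cone_in f)) (Dmap f)) (Dmap (zero_chmap X (cone f))).
Proof.
apply: Deq_trans (Deq_sym (Deq_map_comp _ _)) _.
apply: (homotopic_Deq (k := fun n => linear_of (@cone_homotopy_linear _ _ f n))).
move=> n x; rewrite /= /cone_diff /= /cone_in_fun.
by congr (_, _); rewrite /= ?linear0 ?subr0 ?addr0 ?addNr.
Qed.

End Fractions.

(** * Direct sums of modules and complexes *)

Section DirectSum.
Variables (R : comNzRingType) (I : choiceType).

Section Module.
Variable M : I -> lmodType R.

Record dsum : Type := DSum {
  dsum_fun :> forall i, M i;
  dsum_finite : exists A : {fset I}, forall i, i \notin A -> dsum_fun i = 0
}.

Lemma dsumP (f g : dsum) : (forall i, f i = g i) -> f = g.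
Proof.
case: f g => [f Af] [g Ag] /= fg.
have {}fg : f = g by apply: functional_extensionality_dep.
by subst g; congr DSum; apply: Prop_irrelevance.
Qed.

Fact dsum0_finite : exists A : {fset I}, forall i, i \notin A -> 0 = 0 :> M i.
Proof. by exists fset0%fset. Qed.
Definition dsum0 := DSum dsum0_finite.

Fact dsumD_finite (f g : dsum) :
  exists A : {fset I}, forall i, i \notin A -> f i + g i = 0.
Proof.
case: f g => [f [A Af]] [g [B Bg]] /=; exists (A `|` B)%fset => i.
by rewrite inE negb_or => /andP[/Af-> /Bg->]; rewrite addr0.
Qed.
Definition dsumD f g := DSum (dsumD_finite f g).

Fact dsumN_finite (f : dsum) :
  exists A : {fset I}, forall i, i \notin A -> - f i = 0.
Proof. by case: f => [f [A Af]]; exists A => i /= /Af->; rewrite oppr0. Qed.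
Definition dsumN f := DSum (dsumN_finite f).

Fact dsumZ_finite (a : R) (f : dsum) :
  exists A : {fset I}, forall i, i \notin A -> a *: f i = 0.
Proof. by case: f => [f [A Af]]; exists A => i /= /Af->; rewrite scaler0. Qed.
Definition dsumZ a f := DSum (dsumZ_finite a f).

HB.instance Definition _ := gen_eqMixin dsum.
HB.instance Definition _ := gen_choiceMixin dsum.

Fact dsum_addA : associative dsumD.
Proof. by move=> f g h; apply: dsumP => i; apply: addrA. Qed.
Fact dsum_addC : commutative dsumD.
Proof. by move=> f g; apply: dsumP => i; apply: addrC. Qed.
Fact dsum_add0 : left_id dsum0 dsumD.
Proof. by move=> f; apply: dsumP => i; apply: add0r. Qed.
Fact dsum_addN : left_inverse dsum0 dsumN dsumD.
Proof. by move=> f; apply: dsumP => i; apply: addNr. Qed.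

HB.instance Definition _ :=
  GRing.isZmodule.Build dsum dsum_addA dsum_addC dsum_add0 dsum_addN.

Fact dsum_scaleA a b f : dsumZ a (dsumZ b f) = dsumZ (a * b) f.
Proof. by apply: dsumP => i; apply: scalerA. Qed.
Fact dsum_scale1 : left_id 1 dsumZ.
Proof. by move=> f; apply: dsumP => i; apply: scale1r. Qed.
Fact dsum_scaleDr : right_distributive dsumZ +%R.
Proof. by move=> a f g; apply: dsumP => i; apply: scalerDr. Qed.
Fact dsum_scaleDl f : {morph dsumZ^~ f : a b / a + b}.
Proof. by move=> a b; apply: dsumP => i; apply: scalerDl. Qed.

HB.instance Definition _ :=
  GRing.Zmodule_isLmodule.Build R dsum
    dsum_scaleA dsum_scale1 dsum_scaleDr dsum_scaleDl.

Fact dsum_in_finite i (x : M i) :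
  exists A : {fset I}, forall j, j \notin A -> dfwith (fun j => 0 : M j) x j = 0.
Proof.
exists [fset i]%fset => j; rewrite inE => ji.
by rewrite dfwith_out // eq_sym.
Qed.
Definition dsum_in i (x : M i) : dsum := DSum (dsum_in_finite x).

Fact dsum_in_linear i : linear (@dsum_in i).
Proof.
move=> a x y; apply: dsumP => j /=.
have [<-|ji] := eqVneq i j; first by rewrite !dfwith_in.
by rewrite !dfwith_out // scaler0 addr0.
Qed.

Definition dsum_sum (V : lmodType R) (phi : forall i, {linear M i -> V})
    (f : dsum) : V :=
  \sum_(i \in [set: I]%classic) phi i (f i).

Lemma dsum_sumE (V : lmodType R) (phi : forall i, {linear M i -> V})
    (f : dsum) (A : {fset I}) :
  (forall i, i \notin A -> f i = 0) -> dsum_sum phi f = \sum_(i <- A) phi i (f i).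
Proof. by move=> Af; apply: fsbigTE => i /Af->; rewrite linear0. Qed.

Fact dsum_sum_linear V phi : linear (@dsum_sum V phi).
Proof.
move=> a f g; have [A Af] := dsum_finite f; have [B Bg] := dsum_finite g.
have {}Af i : i \notin (A `|` B)%fset -> f i = 0.
  by rewrite inE negb_or => /andP[/Af].
have {}Bg i : i \notin (A `|` B)%fset -> g i = 0.
  by rewrite inE negb_or => /andP[_ /Bg].
rewrite (dsum_sumE _ Af) (dsum_sumE _ Bg) (@dsum_sumE _ _ _ (A `|` B)%fset).
  by rewrite scaler_sumr -big_split /=; apply: eq_bigr => i _; rewrite linearP.
by move=> i iA; rewrite /= Af // Bg // scaler0 addr0.
Qed.

Lemma dsum_sum_in V phi i (x : M i) : @dsum_sum V phi (dsum_in x) = phi i x.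
Proof.
rewrite (@dsum_sumE _ _ _ [fset i]%fset) => [|j].
  by rewrite big_seq_fset1 /= dfwith_in.
by rewrite inE eq_sym /= => ij; rewrite dfwith_out.
Qed.

End Module.

Section Map.
Variables (M N : I -> lmodType R) (phi : forall i, {linear M i -> N i}).

Fact dsum_map_finite (f : dsum M) :
  exists A : {fset I}, forall i, i \notin A -> phi i (f i) = 0.
Proof. by case: f => [f [A Af]]; exists A => i /= /Af->; rewrite linear0. Qed.
Definition dsum_map (f : dsum M) : dsum N := DSum (dsum_map_finite f).

Fact dsum_map_linear : linear dsum_map.
Proof. by move=> a f g; apply: dsumP => i /=; rewrite linearP. Qed.

Lemma dsum_map_in i (x : M i) : dsum_map (dsum_in x) = dsum_in (phi i x).
Proof.
apply: dsumP => j /=; have [<-|ji] := eqVneq i j; first by rewrite !dfwith_in.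
by rewrite !dfwith_out // linear0.
Qed.
End Map.

Section Complexes.
Variable X : I -> complex R.

Fact csum_diffK n (f : dsum (fun i => X i n)) :
  linear_of (dsum_map_linear (fun i => cdiff (X i) (n + 1)))
    (linear_of (dsum_map_linear (fun i => cdiff (X i) n)) f) = 0.
Proof. by apply: dsumP => i; rewrite /= cdiffK. Qed.

Definition csum : complex R :=
  @Complex R (fun n => dsum (fun i => X i n))
    (fun n => linear_of (dsum_map_linear (fun i => cdiff (X i) n))) csum_diffK.

Fact csum_inE i n (x : X i n) :
  linear_of (@dsum_in_linear (fun i => X i (n + 1)) i) (cdiff (X i) n x)
  = cdiff csum n (linear_of (@dsum_in_linear (fun i => X i n) i) x).
Proof. by rewrite /= dsum_map_in. Qed.

Definition csum_in i : chmap (X i) csum := 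
  @ChMap R (X i) csum (fun n => linear_of (@dsum_in_linear (fun i => X i n) i))
    (@csum_inE i).

Variables (Y : complex R) (f : forall i, chmap (X i) Y).

Fact csum_sumE n (x : csum n) :
  linear_of (dsum_sum_linear (fun i => f i (n + 1))) (cdiff csum n x)
  = cdiff Y n (linear_of (dsum_sum_linear (fun i => f i n)) x).
Proof.
have [A Ax] := dsum_finite x.
rewrite /= (dsum_sumE _ Ax) (@dsum_sumE _ _ _ _ A) => [|i /Ax xi].
  by rewrite linear_sum; apply: eq_bigr => i _ /=; rewrite chmapE.
by rewrite /= xi linear0.
Qed.

Definition csum_sum : chmap csum Y := 
  @ChMap R csum Y (fun n => linear_of (dsum_sum_linear (fun i => f i n))) csum_sumE.
End Complexes.

Section ComplexMap.
Variables (X Y : I -> complex R) (f : forall i, chmap (X i) (Y i)).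

Fact csum_mapE n (x : csum X n) :
  linear_of (dsum_map_linear (fun i => f i (n + 1))) (cdiff (csum X) n x)
  = cdiff (csum Y) n (linear_of (dsum_map_linear (fun i => f i n)) x).
Proof. by apply: dsumP => i /=; rewrite chmapE. Qed.

Definition csum_map : chmap (csum X) (csum Y) := 
  @ChMap R (csum X) (csum Y) (fun n => linear_of (dsum_map_linear (fun i => f i n)))
    csum_mapE.
End ComplexMap.

End DirectSum.

(** * Complexes with torsion cohomology *)

Section Torsion.
Variables (R : comNzRingType) (M : lmodType R).
Implicit Types X Y Z : complex R.

(** For an ideal A this says that there is no nonzero linear map from R / A
    to M. *)
Definition dense (A : R -> Prop) : Prop :=
  forall m : M, (forall r, A r -> r *: m = 0) -> m = 0.

Lemma dense_sub (A B : R -> Prop) : dense A -> (forall r, A r -> B r) -> dense B.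
Proof. by move=> dA AB m Bm; apply: dA => r /AB; apply: Bm. Qed.

(** Closure of the torsion class under extensions, for cyclic modules: if
    R / J and the submodule (A + J) / A of R / A are torsion, then so is
    R / A. *)
Lemma dense_extension (J A : R -> Prop) :
  dense J -> (forall j, J j -> dense (fun r => A (r * j))) -> dense A.
Proof.
move=> dJ dA m Am; apply: dJ => j /dA; apply => r Arj.
by rewrite scalerA; apply: Am.
Qed.

Lemma dense1 (A : R -> Prop) : A 1 -> dense A.
Proof. by move=> A1 m /(_ _ A1); rewrite scale1r. Qed.

(** The set in the definition is the annihilator of the cohomology class of
    x. *)
Definition torsion X n (x : X (n + 1)) : Prop :=
  dense (fun r => coboundary (r *: x)).

Lemma coboundary_torsion X n (x : X (n + 1)) : coboundary x -> torsion x.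
Proof. by move=> xb; apply: dense1; rewrite scale1r. Qed.

Lemma torsionD X n (x y : X (n + 1)) : torsion x -> torsion y -> torsion (x + y).
Proof.
move=> tx ty; apply: dense_extension (tx) _ => j jx.
apply: dense_sub (ty) _ => r ry.
rewrite scalerDr -scalerA mulrC -[_ *: y]scalerA.
by apply: coboundaryD; apply: coboundaryZ.
Qed.

Lemma torsion_sum X n (I : Type) (s : seq I) (F : I -> X (n + 1)) :
  (forall i, torsion (F i)) -> torsion (\sum_(i <- s) F i).
Proof.
move=> tF; elim/big_ind: _ => //; last exact: torsionD.
by apply: coboundary_torsion; apply: coboundary0.
Qed.

Definition torsion_complex X : Prop :=
  forall n (x : X (n + 1)), cocycle x -> torsion x.

(** The class of y comes from a class of X under the isomorphism, and
    annihilators can only grow along the induced map. *)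
Lemma torsion_complex_iso X Y (f : Dhom X Y) :
  is_Diso f -> torsion_complex X -> torsion_complex Y.
Proof.
move=> [g [_ fg]] tX n y yc.
have [x yx] := Hrel_total g yc; have [_ xc] := Hrel_cocycle yx.
have [y' xy'] := Hrel_total f xc.
have [_ _ yy'] : Hrel (Did Y) y y' by apply/(Deq_Hrel fg); exists x.
apply: dense_sub (tX n x xc) _ => r rx.
have ry' : coboundary (r *: y').
  apply: (Hrel_preserves_coboundary (f := f)) rx.
  have := Hrel_linear r xy' (Hrel_coboundaries f (coboundary0 X n) (coboundary0 Y n)).
  by rewrite !addr0.
rewrite -[y](subKr y') scalerBr; apply: coboundaryB => //.
exact: coboundaryZ.
Qed.

Lemma torsion_complex_shift X : torsion_complex X <-> torsion_complex (shift X).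
Proof.
have Xb n (x : X (n + 1 + 1)) :
    @coboundary R (shift X) n x <-> @coboundary R X (n + 1) x.
  split=> -[y ->]; exists (- y); rewrite /= /shift_diff linearN ?opprK //.
split=> tX.
  move=> n x xc; apply: dense_sub (tX (n + 1) x _) _ => [|r /Xb//].
  by move: xc => /eqP; rewrite /= /cocycle /= /shift_diff oppr_eq0 => /eqP.
move=> n; rewrite -(subrK 1 n) => x xc.
apply: dense_sub (tX _ x _) _ => [|r /Xb//].
by rewrite /cocycle /= /shift_diff xc oppr0.
Qed.

(** If j kills the class of x in X, then j (x, y) is cohomologous to the image
    of a class of Y, so [dense_extension] applies. This is the extension
    H(Y) -> H(cone f) -> H(X[1]) read on annihilators. *)
Lemma torsion_complex_cone X Y (f : chmap X Y) :
  torsion_complex X -> torsion_complex Y -> torsion_complex (cone f).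
Proof.
move=> tX tY n [x y] [/eqP]; rewrite oppr_eq0 => /eqP xc yc.
apply: dense_extension (tX _ x xc) _ => j [x' jx].
apply: dense_sub (tY _ (j *: y + f (n + 1) x') _) _ => [|r [y' ry']].
  rewrite /cocycle linearD linearZ /= -chmapE -jx linearZ /= -scalerDr.
  by rewrite [X in _ *: X]addrC yc scaler0.
exists (- (r *: x'), y'); rewrite /= /cone_diff /=; congr (_, _); rewrite /=.
  by rewrite linearN opprK linearZ /= -jx scalerA.
by rewrite -ry' linearN linearZ /= scalerDr addrCA addNr addr0 scalerA.
Qed.

(** Here q is the map to the cone of the numerator g of a left fraction s^-1 g
    representing f. A class killed by q has the same image under s as g x, for
    some class x of X, and s is injective on cohomology: hence r kills the class
    of y as soon as it kills that of x. *)
Lemma torsion_kernel X Y (f : Dhom X Y) : torsion_complex X ->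
  exists (Z : complex R) (q : chmap Y Z),
    Deq (Dcomp (Dmap q) f) (Dmap (zero_chmap X Z)) /\
    (forall n (y : Y (n + 1)),
       cocycle y -> coboundary (q (n + 1) y) -> torsion y).
Proof.
move=> tX; have [V [s [g [qs sf]]]] := left_fraction f.
exists (cone g), (chmap_comp (cone_in g) s); split=> [|n y yc [[x v] /= []]].
  apply: Deq_trans (Deq_compr _ (Deq_map_comp _ _)) _.
  apply: Deq_trans (Deq_compAC _ _ _) _.
  apply: Deq_trans (Deq_compl _ sf) _; exact: Deq_cone_in.
move=> /esym/eqP; rewrite oppr_eq0 => /eqP xc sy.
apply: dense_sub (tX _ x xc) _ => r [x' rx].
have [si _] := qs n; apply: si; first exact: cocycleZ.
exists (g n x' + r *: v).
by rewrite linearZ /= sy scalerDr linearD /= -chmapE -rx !linearZ.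
Qed.

(** The argument is the gluing described at the top: [dcyl nabla qs] is the
    homotopy pushout T of all the q_i along S, and a cocycle a of S that bounds in
    it is cohomologous to the sum of the components b_i of some b, with q_i b_i
    a coboundary for each i. *)
Lemma torsion_complex_coproduct (I : choiceType) (X : I -> complex R) S
    (inj : forall i, Dhom (X i) S) :
  is_coproduct inj -> (forall i, torsion_complex (X i)) -> torsion_complex S.
Proof.
move=> cS tX.
have Q i : exists T : {Z : complex R & chmap S Z},
    Deq (Dcomp (Dmap (tagged T)) (inj i)) (Dmap (zero_chmap (X i) (tag T))) /\
    (forall n (y : S (n + 1)),
       cocycle y -> coboundary (tagged T (n + 1) y) -> torsion y).
  by have [Z [q qP]] := torsion_kernel (inj i) (tX i); exists (existT _ Z q).
pose C i : complex R := tag (sval (cid (Q i))).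
pose q i : chmap S (C i) := tagged (sval (cid (Q i))).
have q0 i : Deq (Dcomp (Dmap (q i)) (inj i)) (Dmap (zero_chmap (X i) (C i))).
  by have [] := svalP (cid (Q i)).
have qt i n (y : S (n + 1)) :
  cocycle y -> coboundary (q i (n + 1) y) -> torsion y.
  by have [_] := svalP (cid (Q i)); apply.
clearbody C q.
pose nabla := csum_sum (fun i : I => chmap_id S); pose qs := csum_map q.
pose iS := dcyl_inl nabla qs; pose iC := dcyl_inr nabla qs.
(* The two legs of the homotopy pushout agree on the i-th copy of S, where nabla
   is the identity: so S -> T factors through q_i in D(R), for every i. *)
have iSE i :
  Deq (Dmap iS) (Dcomp (Dmap iC) (Dcomp (Dmap (csum_in C i)) (Dmap (q i)))).
  pose e := csum_in (fun=> S) i.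
  have nablae : Deq (Dcomp (Dmap nabla) (Dmap e)) (Did S).
    by apply: Deq_mapC => n x /=; rewrite dsum_sum_in.
  have qse : Deq (Dcomp (Dmap qs) (Dmap e))
                 (Dcomp (Dmap (csum_in C i)) (Dmap (q i))).
    apply: Deq_trans (Deq_map_comp _ _); apply: Deq_mapC => n x /=.
    by rewrite dsum_map_in.
  apply: Deq_trans (Deq_sym (Deq_comp1r _)) _.
  apply: Deq_trans (Deq_compl _ (Deq_sym nablae)) _.
  apply: Deq_trans (Deq_compA _ _ _) _.
  apply: Deq_trans (Deq_compr _ (Deq_dcyl _ _)) _.
  by apply: Deq_trans (Deq_compAC _ _ _) _; apply: Deq_compl.
have iS0 : Deq (Dmap iS) (Dmap (zero_chmap S (dcyl nabla qs))).
  have [_ uniq] := cS _ (fun i => Dmap (zero_chmap (X i) (dcyl nabla qs))).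
  apply: uniq => i; apply: Deq_trans (Deq_sym (Deq_zerol _ _)).
  apply: Deq_trans (Deq_compr _ (iSE i)) _.
  apply: Deq_trans (Deq_compAC _ _ _) _.
  apply: Deq_trans (Deq_compl _ (Deq_compAC _ _ _)) _.
  apply: Deq_trans (Deq_compl _ (Deq_compl _ (q0 i))) _.
  apply: Deq_trans (Deq_compl _ (Deq_zeror _ _)) _.
  exact: Deq_zeror.
move=> n a ac.
have : Hrel (Dmap (zero_chmap S (dcyl nabla qs))) a (iS (n + 1) a).
  apply/(Deq_Hrel iS0); split=> //; first exact: cocycle_map.
  by rewrite subrr; apply: coboundary0.
move=> [_ _]; rewrite /= subr0 => -[[[a' b] c] /= E].
have bc i : cdiff S (n + 1) (b i) = 0.
  apply/eqP; rewrite -oppr_eq0 eq_sym; apply/eqP.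
  exact: (congr1 (fun z : dcyl nabla qs (n + 1) =>
    dsum_fun (z.1.2 : csum (fun=> S) _) i) E).
have {}cE i : q i (n + 1) (b i) = cdiff (C i) n (c i).
  apply/esym/eqP; rewrite -subr_eq0 eq_sym; apply/eqP.
  exact: (congr1 (fun z : dcyl nabla qs (n + 1) =>
    dsum_fun (z.2 : csum C _) i) E).
have /= -> := congr1 (fun z : dcyl nabla qs (n + 1) => z.1.1) E.
apply: torsionD; first by apply: coboundary_torsion; exists a'.
have [A Ab] := dsum_finite b; rewrite (dsum_sumE _ Ab).
apply: torsion_sum => i; apply: (qt i n (b i) (bc i)); exists (c i).
exact: cE.
Qed.

Lemma torsion_complex_stalk (N : lmodType R) :
  (forall x : N, dense (fun r => r *: x = 0)) -> torsion_complex (stalk N).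
Proof.
move=> dN n x _.
apply: (dense_sub (A := fun r => r *: x = 0)) => [|r ->]; last first.
  exact: coboundary0.
suff E k (y : stalk_obj N k) : dense (fun r => r *: y = 0) by apply: E.
by case: k y => [[|k]|k] y; [exact: dN|..]; apply: dense1; apply: thinmx0.
Qed.

Lemma torsion_localising : localising_subcategory torsion_complex.
Proof.
split; [split=> [|X Y f||X Y Z f g h]|].
- by apply: torsion_complex_stalk => x; apply: dense1; apply: thinmx0.
- exact: torsion_complex_iso.
- exact: torsion_complex_shift.
- move=> [A [B [u [a [b [c [[ia ib ic] _]]]]]]] tX tY.
  have [c' [c'c cc']] := ic.
  apply: (@torsion_complex_iso (cone u) Z c'); first by exists c.
  apply: torsion_complex_cone; first exact: torsion_complex_iso ia tX.
  exact: torsion_complex_iso ib tY.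
- move=> I X S inj; exact: (@torsion_complex_coproduct {classic I}).
Qed.

Lemma stalk_regular_not_torsion :
  (exists m : M, m <> 0) -> ~ torsion_complex (stalk R^o).
Proof.
move=> [m m0] /(_ (-1) (1 : R^o) erefl) t1; apply/m0/t1 => r [_ /= r0].
have {}r0 : r * 1 = 0 :> R by [].
by rewrite -[r]mulr1 r0 scale0r.
Qed.

(** Otherwise p is the annihilator of some nonzero m, and R m is simple: given
    r outside p with r = r^2 y, the element 1 - r y lies in p, so m = r y m
    belongs to the submodule generated by r m. *)
Lemma dense_prime (p : Spec R) : absolutely_flat R ->
  ~ (exists N : M -> Prop, is_simple_submodule N) ->
  dense (fun r => r \in (p : pred R)).
Proof.
move=> Rflat nosimple m pm; apply: contrapT => m0; apply: nosimple.
exists (fun y => exists r, y = r *: m); split.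
- split=> [|a _ _ [r ->] [s ->]]; first by exists 0; rewrite scale0r.
  by exists (a * r + s); rewrite scalerDl scalerA.
- by exists m => //; exists 1; rewrite scale1r.
move=> L [L0 Llin] LN.
have [Lm|Lm] := pselect (L m).
  right=> _ [r ->]; rewrite -[_ *: _]addr0; exact: Llin.
left=> x Lx; have [r xE] := LN x Lx; apply: contrapT => x0.
have rp : r \notin (p : pred R) by apply/negP => /pm; rewrite -xE.
have [y ry] := Rflat r.
have : r * (1 - r * y) \in (p : pred R).
  by rewrite mulrBr mulr1 mulrA -expr2 -ry subrr rpred0.
rewrite prime_idealrM (negPf rp) /= => /pm/eqP.
rewrite scalerBl scale1r subr_eq0 => /eqP mE; apply: Lm.
rewrite mE mulrC -scalerA -xE -[_ *: _]addr0; exact: Llin.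
Qed.

Lemma residue_field_annihilator (p : Spec R) (r : R) (x : residue_field p) :
  r \in (p : pred R) -> r *: x = 0.
Proof.
move=> rp; suff r0 : to_residue_field p r = 0.
  by rewrite -[LHS]/(_ * x) r0 mul0r.
rewrite /to_residue_field.
suff -> : \pi_({ideal_quot p})%qT r = 0 by rewrite tofrac0.
apply/eqP; rewrite -[0](rmorph0 (\pi_({ideal_quot p})%qT)) -Quotient.idealrBE.
by rewrite subr0.
Qed.

End Torsion.

Theorem theorem4p7 (R : comNzRingType)
    (Rflat : absolutely_flat R)
    (Rnoeth : ~ noetherian R)
    (Rsart : ~ semi_artinian R) :
  strict_subcategory (localising_closure (residue_fields R)) (whole_category R).
Proof.
split=> //; exists (stalk R^o) => // gen; apply: Rsart => M f _ M0.
apply: contrapT => nosimple; apply: (@stalk_regular_not_torsion R M) => //.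
apply: gen (torsion_localising M) _ => _ [p ->].
apply: torsion_complex_stalk => x.
apply: dense_sub (dense_prime Rflat nosimple) _ => r.
exact: residue_field_annihilator.
Qed.
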